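(* Let $n$ be a natural number. For any point $\underline{z}=(z_1,\ldots,z_n)\in\mathbb{C}^n$ and any $\mathfrak{m}_{\underline{z}}$-primary ideal $I\subset\mathbb{C}[X_1,\ldots,X_n]$, where $\mathfrak{m}_{\underline{z}}:=(X_1-z_1,\ldots,X_n-z_n)$, the closure $\overline{I}$ of $I$ with respect to the norm $\bigl\Vert\sum_{\underline{k}} a_{\underline{k}}\underline{X}^{\underline{k}}\bigr\Vert=\sum_{\underline{k}}|a_{\underline{k}}|$ is given by $$\overline{I}=\begin{cases} I+(X_j-z_j)_{1\le j\le n,\ |z_j|=1} & \text{if } \underline{z}\in\mathbb{B}^n,\\ (1) & \text{if } \underline{z}\notin\mathbb{B}^n.\end{cases}$$
   Context: Here $\underline{X}=(X_1,\ldots,X_n)$, $\mathbb{B}=\{z\in\mathbb{C}:|z|\le 1\}$ is the closed unit disc, and $\mathbb{C}[\underline{X}]$ is a normed algebra with the $\ell_1$-norm on coefficients $\bigl\Vert\sum_{\underline{k}} a_{\underline{k}}\underline{X}^{\underline{k}}\bigr\Vert:=\sum_{\underline{k}}|a_{\underline{k}}|$. The closure is taken inside $\mathbb{C}[\underline{X}]$. The notation $(X_j-z_j)_{1\le j\le n,\ |z_j|=1}$ means the ideal generated by those $X_j-z_j$ with $|z_j|=1$. *)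

(* Defs.v *)
From HB Require Import structures.
From mathcomp Require Import all_boot all_order all_algebra.
From mathcomp Require Import mpoly complex.
From mathcomp Require Import boolp classical_sets reals topology normedtype.

Set Implicit Arguments.
Unset Strict Implicit.
Unset Printing Implicit Defensive.

Import Order.TTheory GRing.Theory Num.Theory.
Import numFieldNormedType.Exports.

Local Open Scope classical_set_scope.
Local Open Scope ring_scope.

Section Ideals.
Variable A : comNzRingType.
Implicit Types I J G : set A.

(* Not [idealr_closed], which only describes proper ideals. *)
Definition is_ideal I : Prop :=
  I 0 /\ forall a x y, I x -> I y -> I (a * x + y).

Definition ideal_gen G : set A := smallest is_ideal G.

Definition ideal_add I J : set A := [set x + y | x in I & y in J].

Definition radical I : set A := [set x | exists k : nat, I (x ^+ k.+1)].

Definition primary_ideal I : Prop :=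
  [/\ is_ideal I, ~ I 1 &
      forall x y, I (x * y) -> I x \/ exists k : nat, I (y ^+ k.+1)].

Definition primary_to I J : Prop := primary_ideal I /\ radical I = J.

End Ideals.

Section L1Norm.
Variables (n : nat) (K : numFieldType).
Implicit Types p q : {mpoly K[n]}.

Definition l1norm p : K := \sum_(m <- msupp p) `|p@_m|.

Lemma l1normE p (s : seq 'X_{1..n}) :
  uniq s -> {subset msupp p <= s} -> l1norm p = \sum_(m <- s) `|p@_m|.
Proof.
move=> us sub; rewrite [RHS](bigID (mem (msupp p))) /=.
rewrite [X in _ + X]big1 ?addr0; last first.
  by move=> m /memN_msupp_eq0 ->; rewrite normr0.
rewrite -big_filter; apply: perm_big; apply: uniq_perm.
- exact: msupp_uniq.
- exact: filter_uniq.
- by move=> m; rewrite mem_filter; case: (boolP (m \in msupp p)) => // /sub ->.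
Qed.

Lemma l1normD p q : l1norm (p + q) <= l1norm p + l1norm q.
Proof.
pose s := undup (msupp p ++ msupp q).
have us : uniq s by exact: undup_uniq.
have sp : {subset msupp p <= s}.
  by move=> m mp; rewrite mem_undup mem_cat mp.
have sq : {subset msupp q <= s}.
  by move=> m mq; rewrite mem_undup mem_cat mq orbT.
have spq : {subset msupp (p + q) <= s}.
  by move=> m /msuppD_le; rewrite mem_undup.
rewrite (l1normE us sp) (l1normE us sq) (l1normE us spq) -big_split /=.
by apply: ler_sum => m _; rewrite mcoeffD ler_normD.
Qed.

Lemma l1normZ (c : K) p : l1norm (c *: p) = `|c| * l1norm p.
Proof.
rewrite (l1normE (msupp_uniq p) (@msuppZ_le _ _ c p)) mulr_sumr.
by apply: eq_bigr => m _; rewrite mcoeffZ normrM.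
Qed.

Lemma l1norm0_eq0 p : l1norm p = 0 -> p = 0.
Proof.
move/eqP; rewrite psumr_eq0 => [/allP nul|m _]; last exact: normr_ge0.
apply/mpolyP => m; rewrite mcoeff0.
have [/nul /=|/memN_msupp_eq0 //] := boolP (m \in msupp p).
by rewrite normr_eq0 => /eqP.
Qed.

(* For K = R[i] the norm takes values in R[i]; since 0 < e in R[i] forces e to be
   real, the balls of the induced topology are the usual ones. *)
HB.instance Definition _ :=
  Lmodule_isNormed.Build K {mpoly K[n]} l1normD l1normZ l1norm0_eq0.

End L1Norm.

Section PointIdeals.
Variables (R : realType) (n : nat).
Implicit Type z : 'I_n -> R[i].

Definition max_ideal z : set {mpoly R[i][n]} :=
  ideal_gen (range (fun j => 'X_j - (z j)%:MP)).

Definition circle_ideal z : set {mpoly R[i][n]} :=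
  ideal_gen [set 'X_j - (z j)%:MP | j in [set j | `|z j| = 1]].

End PointIdeals.

(* Main.v *)
(** The norm is submultiplicative, so the closure [J] of [I] is a closed ideal,
and it contains a power of every [X_j - z_j].  Put [Y = X_j / z_j] and
[u = Y - 1].  If [|z_j| > 1], then [Y ^ N] tends to 0, so [u ^ k] is the limit
of the multiples [u ^ k * (1 - Y ^ N)] of [u ^ k.+1]; descending on [k] gives
[1] in [J].  If [|z_j| = 1], then [Y] is power bounded and a Cesaro mean
argument gives the same descent down to [u].

Conversely, let [|z_j| <= 1] for all [j] and [K = I + (X_j - z_j : |z_j| = 1)].
Modulo [K], expand every monomial in powers of [X_j - z_j], keeping only the
constant term when [|z_j| = 1] and finitely many terms otherwise.  The
coefficients are bounded functions of the monomial (for [|z_j| < 1],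
[binom m i * z_j ^ (m - i)] is bounded in [m]), so they extend to finitely many
l1-bounded functionals whose common kernel lies in [K]; hence [K] is closed. *)

Require Import Defs.
From mathcomp Require Import all_boot all_order all_algebra.
From mathcomp Require Import mpoly complex.
From mathcomp Require Import boolp classical_sets reals topology normedtype.

Import Order.TTheory GRing.Theory Num.Theory.
Import numFieldNormedType.Exports.

Local Open Scope classical_set_scope.
Local Open Scope ring_scope.

(** * Closures and bounded functionals in a normed space *)

Section Functionals.
Context {K : numFieldType} {V : normedModType K}.
Implicit Types (A : set V) (f : V -> K).

Lemma closure_normP A x :
  closure A x <-> forall e : K, 0 < e -> exists2 y, A y & `|x - y| < e.
Proof.
split=> [clx e e0|clx B /nbhs_ballP[e /= e0 sB]].
  have [|y [Ay]] := clx (ball x e); first exact: nbhsx_ballx.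
  by rewrite -ball_normE /= => xy; exists y.
have [y Ay xy] := clx e e0; exists y; split=> //; apply: sB.
by rewrite -ball_normE.
Qed.

Definition subspace A := A 0 /\ forall (a : K) x y, A x -> A y -> A (a *: x + y).

Definition bounded_functional f :=
  (forall (a : K) x y, f (a *: x + y) = a * f x + f y) /\
  exists C : K, forall x, `|f x| <= C * `|x|.

Lemma bounded_functionalB f g (a : K) :
  bounded_functional f -> bounded_functional g ->
  bounded_functional (fun x => f x - a * g x).
Proof.
move=> [lf [C fC]] [lg [D gD]]; split=> [b x y|].
  by rewrite lf lg mulrDr mulrBr opprD addrACA mulrCA.
exists (C + `|a| * D) => x; rewrite mulrDl -mulrA.
apply: le_trans (ler_normB _ _) _; rewrite normrM lerD //.
by rewrite ler_wpM2l.
Qed.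

Lemma bounded_functional0 f : bounded_functional f -> f 0 = 0.
Proof.
by move=> [lf _]; have := lf (-1) 0 0; rewrite scaler0 add0r mulN1r addNr.
Qed.

Lemma closure_ker f A : bounded_functional f ->
  (forall x, A x -> f x = 0) -> forall x, closure A x -> f x = 0.
Proof.
move=> [lf [C fC]] Af x /closure_normP clx.
apply/eqP; rewrite -normr_eq0 eq_le normr_ge0 andbT.
apply/ler_addgt0Pr => e e0; rewrite add0r.
(* [C] may be 0, so [|C| + 1] serves as a positive Lipschitz constant. *)
have D0 : 0 < `|C| + 1 by rewrite ltr_wpDl.
have [y Ay xy] := clx (e / (`|C| + 1)) (divr_gt0 e0 D0).
have -> : f x = f (x - y).
  by have := lf 1 (x - y) y; rewrite scale1r subrK mul1r (Af y Ay) addr0.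
apply: le_trans (fC _) _.
have /le_trans : C * `|x - y| <= (`|C| + 1) * `|x - y|.
  have -> : C * `|x - y| = `|C * `|x - y| |.
    rewrite [RHS]ger0_norm //; exact: le_trans (fC _).
  by rewrite normrM normr_id ler_wpM2r // lerDl.
apply; rewrite mulrC -ler_pdivlMr //; exact: ltW.
Qed.

(* Elimination: if [f d] does not vanish on [A], pick [u] in [A] with
   [f d u != 0] and subtract from the other functionals the multiple of [f d]
   that kills [u]; if it does, it vanishes on [closure A] and is absorbed in
   the ambient subspace [Z]. *)
Lemma closure_sub_finite_codim {d : nat} {f : nat -> V -> K} {A Z : set V} :
  subspace A -> subspace Z -> closure A `<=` Z ->
  (forall i, bounded_functional (f i)) ->
  (forall x, Z x -> (forall i, (i < d)%N -> f i x = 0) -> A x) ->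
  closure A `<=` A.
Proof.
move=> sA; elim: d f Z => [|d IH] f Z sZ AZ bf ZA.
  by move=> x /AZ Zx; apply: ZA.
have [fA|/existsNP[u /not_implyP[Au /eqP fu]]] :=
    pselect (forall x, A x -> f d x = 0).
  apply: (IH f (fun x => Z x /\ f d x = 0)) => //.
  - split=> [|a x y [Zx fx] [Zy fy]].
      by split; [exact: sZ.1|exact: bounded_functional0].
    by split; [exact: sZ.2|rewrite (bf d).1 fx fy mulr0 addr0].
  - by move=> x Ax; split; [exact: AZ|exact: closure_ker Ax].
  - move=> x [Zx fx] xd; apply: ZA => // i; rewrite ltnS leq_eqVlt.
    by move=> /predU1P[->//|]; exact: xd.
apply: (IH (fun i x => f i x - f i u / f d u * f d x) Z) => //.
  by move=> i; exact: bounded_functionalB.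
move=> x Zx xd; pose c := f d x / f d u.
have Zu : Z u by apply/AZ/subset_closure.
have -> : x = c *: u + (- c *: u + x) by rewrite scaleNr addNKr.
apply: (sA.2) => //; apply: ZA; first exact: sZ.2.
move=> i; rewrite ltnS leq_eqVlt (bf i).1 => /predU1P[->|/xd <-].
  by rewrite mulNr divfK // addNr.
by rewrite addrC mulNr mulrAC [f d x * _]mulrC [in RHS]mulrAC.
Qed.

End Functionals.

(** * The l1-norm and coefficient functionals on polynomials *)

Section L1.
Context {K : numFieldType} {n : nat}.
Implicit Types p q : {mpoly K[n]}.

Lemma norm_mpolyE p : `|p| = \sum_(m <- msupp p) `|p@_m|.
Proof. by []. Qed.

Lemma norm_mpolyX (m : 'X_{1..n}) : `|'X_[m] : {mpoly K[n]}| = 1.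
Proof. by rewrite norm_mpolyE msuppX big_seq1 mcoeffX eqxx normr1. Qed.

Lemma norm_mpolyM p q : `|p * q| <= `|p| * `|q|.
Proof.
rewrite {1}[p]mpolyE {1}[q]mpolyE big_distrl /=.
rewrite (norm_mpolyE p) (norm_mpolyE q) big_distrl /=.
apply: le_trans (ler_norm_sum _ _ _) _; apply: ler_sum => m _.
rewrite !mulr_sumr.
apply: le_trans (ler_norm_sum _ _ _) _; apply: ler_sum => m' _.
by rewrite -scalerAl -scalerAr scalerA -mpolyXD normrZ norm_mpolyX mulr1 normrM.
Qed.

Lemma norm_mpolyMX p q (k : nat) : `|p * q ^+ k| <= `|p| * `|q| ^+ k.
Proof.
elim: k => [|k IH]; first by rewrite !mulr1.
rewrite !exprSr !mulrA; apply: le_trans (norm_mpolyM _ _) _.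
by rewrite ler_wpM2r.
Qed.

Lemma weighted_coefs_bounded (c : 'X_{1..n} -> K) (C : K) :
  (forall m, `|c m| <= C) ->
  bounded_functional (fun p => \sum_(m <- msupp p) p@_m * c m).
Proof.
move=> cC; pose F s p := \sum_(m <- s) p@_m * c m.
(* The range [msupp p] varies with [p]; linearity is checked on one list containing all supports
   involved. *)
have FE p s : uniq s -> {subset msupp p <= s} ->
    \sum_(m <- msupp p) p@_m * c m = F s p.
  move=> us sub; rewrite /F [RHS](bigID (mem (msupp p))) /=.
  rewrite [X in _ + X]big1 ?addr0; last first.
    by move=> m /memN_msupp_eq0 ->; rewrite mul0r.
  rewrite -[RHS]big_filter; apply: perm_big; apply: uniq_perm.
  - exact: msupp_uniq.
  - exact: filter_uniq.
  - by move=> m; rewrite mem_filter; case: (boolP (m \in msupp p)) => // /sub ->.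
split=> [a p q|].
  pose s := undup (msupp p ++ msupp q).
  have us : uniq s by exact: undup_uniq.
  rewrite !(FE _ s) //.
  - rewrite /F mulr_sumr -big_split /=; apply: eq_bigr => m _.
    by rewrite mcoeffD mcoeffZ mulrDl mulrA.
  - by move=> m mq; rewrite mem_undup mem_cat mq orbT.
  - by move=> m mp; rewrite mem_undup mem_cat mp.
  - move=> m /msuppD_le; rewrite mem_undup !mem_cat => /orP[|->].
      by move=> /msuppZ_le ->.
    by rewrite orbT.
exists C => p; rewrite norm_mpolyE mulr_sumr.
apply: le_trans (ler_norm_sum _ _ _) _; apply: ler_sum => m _.
by rewrite normrM mulrC ler_wpM2r.
Qed.

End L1.

(** * Ideal arithmetic *)

Section IdealOperations.
Context {A : comNzRingType} {I : set A} (idI : is_ideal I).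

Lemma idealM a x : I x -> I (a * x).
Proof. by move=> Ix; rewrite -[_ * _]addr0; apply: idI.2 => //; exact: idI.1. Qed.

Lemma idealD x y : I x -> I y -> I (x + y).
Proof. by move=> Ix Iy; rewrite -[x]mul1r; exact: idI.2. Qed.

Lemma idealN x : I x -> I (- x).
Proof. by rewrite -mulN1r; exact: idealM. Qed.

Lemma ideal_sum (T : Type) (r : seq T) (F : T -> A) :
  (forall t, I (F t)) -> I (\sum_(t <- r) F t).
Proof. by move=> IF; apply: big_ind => //; [exact: idI.1|exact: idealD]. Qed.

Lemma ideal_congr_prod (T : Type) (r : seq T) (F G : T -> A) :
  (forall t, I (F t - G t)) -> I (\prod_(t <- r) F t - \prod_(t <- r) G t).
Proof.
move=> IFG; apply: (big_ind2 (fun x y => I (x - y))) => //.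
  by rewrite subrr; exact: idI.1.
move=> x x' y y' Ix Iy.
have -> : x * y - x' * y' = x * (y - y') + y' * (x - x').
  by rewrite !mulrBr addrA [y' * x]mulrC subrK [y' * x']mulrC.
by apply: idealD; exact: idealM.
Qed.

Lemma ideal_pow_le x (k l : nat) : (k <= l)%N -> I (x ^+ k) -> I (x ^+ l).
Proof. by move=> kl Ix; rewrite -(subnK kl) exprD; exact: idealM. Qed.

End IdealOperations.

Lemma ideal_gen_ideal {A : comNzRingType} (G : set A) : is_ideal (ideal_gen G).
Proof.
split=> [J [[] //]|a x y Gx Gy J [idJ GJ]].
by apply: idJ.2; [exact: Gx|exact: Gy].
Qed.

Lemma ideal_add_ideal {A : comNzRingType} (I J : set A) :
  is_ideal I -> is_ideal J -> is_ideal (ideal_add I J).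
Proof.
move=> idI idJ; split.
  by exists 0; [exact: idI.1|exists 0; [exact: idJ.1|rewrite addr0]].
move=> a _ _ [x Ix [y Jy <-]] [x' Ix' [y' Jy' <-]].
exists (a * x + x'); first exact: idI.2.
exists (a * y + y'); first exact: idJ.2.
by rewrite mulrDr addrACA.
Qed.

(** * Closedness of ideals through Taylor expansion *)

Section ClosedByTaylor.
Context {K : numFieldType} {n : nat}.
Implicit Types I : set {mpoly K[n]}.

Lemma ideal_subspace I : is_ideal I -> subspace I.
Proof.
move=> idI; split=> [|a x y Ix Iy]; first exact: idI.1.
by rewrite -mul_mpolyC; exact: idI.2.
Qed.

Lemma closure_ideal I : is_ideal I -> is_ideal (closure I).
Proof.
move=> idI; split=> [|a x y /closure_normP clx /closure_normP cly].
  by apply: subset_closure; exact: idI.1.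
apply/closure_normP => e e0.
(* Multiplication by [a] is continuous by submultiplicativity; the [+ 1] covers [a = 0]. *)
have a0 : 0 < `|a| + 1 by rewrite ltr_wpDl.
have e20 : 0 < e / 2 by rewrite divr_gt0.
have [x' Ix' xx'] := clx _ (divr_gt0 e20 a0).
have [y' Iy' yy'] := cly _ e20.
exists (a * x' + y'); first exact: idI.2.
rewrite opprD addrACA -mulrBr [ltRHS]splitr.
apply: le_lt_trans (ler_normD _ _) _; rewrite ler_ltD //.
apply: le_trans (norm_mpolyM _ _) _.
apply: (@le_trans _ _ ((`|a| + 1) * `|x - x'|)); first by rewrite ler_wpM2r // lerDl.
by rewrite mulrC -ler_pdivlMr // ltW.
Qed.

(* The coefficients of [X ^ m] in powers of [X - w], i.e. [binom m i * w ^ (m - i)]. *)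
Fixpoint taylor_coef (w : K) (m i : nat) : K :=
  match m, i with
  | 0, 0 => 1
  | 0, _.+1 => 0
  | m'.+1, 0 => w * taylor_coef w m' 0
  | m'.+1, i'.+1 => w * taylor_coef w m' i + taylor_coef w m' i'
  end.

(** With [B = (1 - |w|)^-1], the recursion preserves the bound because
    [B ^ i.+1 = |w| * B ^ i.+1 + B ^ i]. *)
Lemma taylor_coef_bound (w : K) (m i : nat) :
  `|w| < 1 -> `|taylor_coef w m i| <= (1 - `|w|)^-1 ^+ i.
Proof.
move=> w1; have B0 : 0 < 1 - `|w| by rewrite subr_gt0.
elim: m i => [|m IH] [|i] /=.
- by rewrite normr1.
- by rewrite normr0 exprn_ge0 // invr_ge0 ltW.
- by rewrite normrM mulr_ile1 // ?(ltW w1) //; exact: (IH 0%N).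
apply: le_trans (ler_normD _ _) _; rewrite normrM.
have -> : (1 - `|w|)^-1 ^+ i.+1 =
    `|w| * (1 - `|w|)^-1 ^+ i.+1 + (1 - `|w|)^-1 ^+ i.
  apply/eqP; rewrite -subr_eq0 opprD addrA -{1}[_ ^+ i.+1]mul1r -mulrBl.
  by rewrite exprS mulrA divff ?mul1r ?subrr // gt_eqF.
by rewrite lerD // ler_wpM2l.
Qed.

(** Multiplying by [Y = w + (Y - w)] reproduces the recursion of [taylor_coef], up to a multiple of
    [(Y - w) ^ N.+1], which lies in [I]. *)
Lemma taylor_congr I (Y : {mpoly K[n]}) (w : K) (N m : nat) :
  is_ideal I -> I ((Y - w%:MP) ^+ N.+1) ->
  I (Y ^+ m - \sum_(i < N.+1) taylor_coef w m i *: (Y - w%:MP) ^+ i).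
Proof.
move=> idI; set u := Y - w%:MP => IuN; elim: m => [|m IH].
  rewrite big_ord_recl /= big1 ?addr0 => [|i _]; last by rewrite scale0r.
  by rewrite scale1r subrr; exact: idI.1.
set T := fun m => \sum_(i < N.+1) taylor_coef w m i *: u ^+ i.
suff -> : Y ^+ m.+1 - T m.+1 =
    Y * (Y ^+ m - T m) + (taylor_coef w m N)%:MP * u ^+ N.+1.
  by apply: (idealD idI); exact: (idealM idI).
have uT : u * T m = \sum_(i < N) taylor_coef w m i *: u ^+ i.+1 +
    taylor_coef w m N *: u ^+ N.+1.
  rewrite mulr_sumr big_ord_recr /= -scalerAr -exprS; congr (_ + _).
  by apply: eq_bigr => i _; rewrite -scalerAr -exprS.
have wT : w *: T m = (w * taylor_coef w m 0) *: u ^+ 0 +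
    \sum_(i < N) (w * taylor_coef w m i.+1) *: u ^+ i.+1.
  rewrite scaler_sumr big_ord_recl scalerA; congr (_ + _).
  by apply: eq_bigr => i _; rewrite scalerA.
have YT : Y * T m = T m.+1 + taylor_coef w m N *: u ^+ N.+1.
  rewrite -(subrK w%:MP Y) mulrDl mul_mpolyC -/u uT wT addrC addrA.
  congr (_ + _); rewrite [RHS]big_ord_recl -addrA -big_split.
  by congr (_ + _); apply: eq_bigr => i _; rewrite /= -scalerDl.
by rewrite mulrBr -exprS YT mul_mpolyC opprD addrA subrK.
Qed.

(** Multiplying the expansions over [j] writes each monomial, modulo [I], in finitely many products
    of the [e j i]. The coefficients are bounded in the monomial, hence define bounded functionals,
    and their common kernel lies in [I]. *)
Lemma closed_of_power_expansion I (N : nat) (e : 'I_n -> 'I_N.+1 -> {mpoly K[n]})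
    (c : 'I_n -> nat -> 'I_N.+1 -> K) :
  is_ideal I ->
  (forall j i, exists C, forall m, `|c j m i| <= C) ->
  (forall j m, I ('X_j ^+ m - \sum_(i < N.+1) c j m i *: e j i)) ->
  closure I `<=` I.
Proof.
move=> idI /(_ _)/choice cC cI.
pose C j := projT1 (cC j).
have CP j i m : `|c j m i| <= C j i by exact: (projT2 (cC j)).
pose T := {ffun 'I_n -> 'I_N.+1}.
pose cf (al : T) (m : 'X_{1..n}) := \prod_j c j (m j) (al j).
pose f (al : T) p := \sum_(m <- msupp p) p@_m * cf al m.
have bf al : bounded_functional (f al).
  apply: (@weighted_coefs_bounded _ _ _ (\prod_j C j (al j))) => m.
  by rewrite normr_prod; apply: ler_prod => j _; rewrite normr_ge0 CP.
pose al0 : T := [ffun => ord0].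
apply: (@closure_sub_finite_codim _ _ (size (enum T))
  (fun k => f (nth al0 (enum T) k)) I setT) => //; first exact: ideal_subspace.
move=> p _ fp; have {}fp al : f al p = 0.
  have alT : al \in enum T by rewrite mem_enum.
  by rewrite -(nth_index al0 alT) fp // index_mem.
(* The subtracted terms add up to the sum of the [f al p *: \prod_j e j (al j)], which is 0. *)
have -> : p = \sum_(m <- msupp p) p@_m *:
    ('X_[m] - \sum_(al : T) cf al m *: \prod_j e j (al j)).
  rewrite {1}[p]mpolyE; apply/eqP; rewrite -subr_eq0 -sumrB.
  rewrite (eq_bigr (fun m => \sum_(al : T) (p@_m * cf al m) *: \prod_j e j (al j))).
    rewrite exchange_big /= big1 // => al _.
    by rewrite -scaler_suml [X in X *: _]fp scale0r.
  move=> m _; rewrite scalerBr opprB addrC subrK scaler_sumr.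
  by apply: eq_bigr => al _; rewrite scalerA.
apply: ideal_sum => // m; rewrite -mul_mpolyC; apply: idealM => //.
have -> : \sum_(al : T) cf al m *: \prod_j e j (al j) =
    \prod_j \sum_(i < N.+1) c j (m j) i *: e j i.
  by rewrite bigA_distr_bigA; apply: eq_bigr => al _; rewrite scaler_prod.
by rewrite mpolyXE_id; apply: ideal_congr_prod.
Qed.

End ClosedByTaylor.

(** * Descent of powers in closed ideals, and the closed polydisc *)

Lemma geometric_decay {K : numFieldType} (r : K) (N : nat) :
  0 <= r -> r < 1 -> r ^+ N * N.+1%:R <= (1 - r)^-1.
Proof.
move=> r0 r1; have s0 : 0 < 1 - r by rewrite subr_gt0.
rewrite -[leRHS]mul1r ler_pdivlMr //.
(* Each [r ^ i] with [i <= N] is at least [r ^ N], and the geometric sum telescopes. *)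
apply: (@le_trans _ _ ((\sum_(i < N.+1) r ^+ i) * (1 - r))).
  rewrite ler_wpM2r ?(ltW s0) // mulr_natr -[X in _ *+ X]card_ord -sumr_const.
  by apply: ler_sum => i _; rewrite ler_wiXn2l ?(ltW r1) // -ltnS.
by rewrite mulrC -opprB mulNr -subrX1 opprB gerBl exprn_ge0.
Qed.

Section ComplexCoefficients.
Context {R : realType} {n : nat}.
Implicit Types (J : set {mpoly R[i][n]}) (Y p : {mpoly R[i][n]}).

Lemma complex_archimedean (x : R[i]) : 0 <= x -> exists N : nat, x < N.+1%:R.
Proof.
case: x => a b; rewrite lecE /= => /andP[/eqP-> a0]; exists (Num.bound a).
have -> : (Num.bound a).+1%:R = ((Num.bound a).+1%:R)%:C%C :> R[i].
  by rewrite rmorph_nat.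
rewrite ltcR; apply: lt_trans (archi_boundP a0) _.
by rewrite ltr_nat.
Qed.

Lemma closed_of_rate J (C : R[i]) p : closure J `<=` J ->
  (forall N : nat, exists2 q, J q & `|p - q| * N.+1%:R <= C) -> J p.
Proof.
move=> clJ rate; apply: clJ; apply/closure_normP => e e0.
have C0 : 0 <= C by have [q _] := rate 0%N; apply: le_trans; rewrite mulr_ge0.
have [N CN] := complex_archimedean _ (divr_ge0 C0 (ltW e0)).
have [q Jq pq] := rate N; exists q => //.
rewrite -(ltr_pM2r (ltr0Sn _ N)); apply: le_lt_trans pq _.
by rewrite mulrC -ltr_pdivrMr.
Qed.

Lemma pow_descent_lt1 J Y (k : nat) : is_ideal J -> closure J `<=` J ->
  `|Y| < 1 -> J ((Y - 1) ^+ k.+1) -> J ((Y - 1) ^+ k).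
Proof.
move=> idJ clJ Y1 Jk; set u := Y - 1.
apply: (@closed_of_rate _ (`|u ^+ k| * (1 - `|Y|)^-1)) => // N.
(* This is a multiple of [u ^ k.+1], as [u] divides [1 - Y ^ N]; the error is [u ^ k * Y ^ N]. *)
exists (u ^+ k - u ^+ k * Y ^+ N).
  rewrite -[u ^+ k in X in X - _]mulr1 -mulrBr -opprB subrX1 mulrN.
  by rewrite mulrA -exprSr; apply/(idealN idJ); rewrite mulrC; apply: (idealM idJ).
rewrite opprB addrC subrK.
apply: (@le_trans _ _ (`|u ^+ k| * (`|Y| ^+ N * N.+1%:R))).
  by rewrite mulrA ler_wpM2r // norm_mpolyMX.
by rewrite ler_wpM2l // geometric_decay.
Qed.

(* Writing [S] for the Cesaro mean of [1, Y, ..., Y ^ N], the polynomial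
   [u ^ k.+1 * (1 - S)] is in [J] because [u] divides [1 - S], and
   [u * S = (Y ^ N.+1 - 1) / N.+1] is small because [Y] is power bounded. *)
Lemma pow_descent_le1 J Y (k : nat) : is_ideal J -> closure J `<=` J ->
  `|Y| <= 1 -> J ((Y - 1) ^+ k.+2) -> J ((Y - 1) ^+ k.+1).
Proof.
move=> idJ clJ Y1 Jk; set u := Y - 1.
apply: (@closed_of_rate _ (`|u ^+ k| * 2)) => // N.
pose S := \sum_(i < N.+1) Y ^+ i.
exists (u ^+ k.+1 - (N.+1%:R^-1)%:MP * (u ^+ k.+1 * S)).
  have -> : u ^+ k.+1 - (N.+1%:R^-1)%:MP * (u ^+ k.+1 * S) =
      (N.+1%:R^-1)%:MP * \sum_(i < N.+1) (u ^+ k.+1 - u ^+ k.+1 * Y ^+ i).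
    rewrite sumrB sumr_const card_ord mulr_sumr mulrBr; congr (_ - _).
    by rewrite mul_mpolyC -[u ^+ _ *+ _](@scaler_nat R[i]) scalerA mulVf ?scale1r // pnatr_eq0.
  apply: (idealM idJ); apply: (ideal_sum idJ) => i.
  rewrite -[u ^+ k.+1 in X in X - _]mulr1 -mulrBr -opprB subrX1 mulrN.
  by rewrite mulrA -exprSr; apply/(idealN idJ); rewrite mulrC; apply: (idealM idJ).
rewrite opprB addrC subrK exprSr -mulrA -subrX1 mul_mpolyC normrZ.
rewrite ger0_norm ?invr_ge0 // mulrAC mulVf ?pnatr_eq0 // mul1r mulrBr mulr1.
apply: le_trans (ler_normB _ _) _; rewrite mulr_natr mulr2n lerD //.
apply: le_trans (norm_mpolyMX _ _ _) _.
by rewrite ler_piMr // exprn_ile1.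
Qed.

Section Point.
Context {J : set {mpoly R[i][n]}} (idJ : is_ideal J) (clJ : closure J `<=` J).
Context {j : 'I_n} {w : R[i]}.

(** Dividing by the unit [w] leads to [Y - 1] with [|Y| = |w|^-1], the form used by the descents. *)
Let rescale : w != 0 -> 'X_j - w%:MP = w%:MP * (w^-1 *: 'X_j - 1) :> {mpoly R[i][n]}.
Proof.
by move=> w0; rewrite mulrBr mulr1 mul_mpolyC scalerA divff // scale1r.
Qed.

Let rescaleV k : w != 0 -> J (('X_j - w%:MP) ^+ k) -> J ((w^-1 *: 'X_j - 1) ^+ k).
Proof.
move=> w0; rewrite rescale // exprMn => /(idealM idJ (w^-1%:MP ^+ k)).
by rewrite mulrA -exprMn -mpolyCM mulVf // expr1n mul1r.
Qed.

Lemma closed_ideal_trivial (k : nat) :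
  1 < `|w| -> J (('X_j - w%:MP) ^+ k) -> J 1.
Proof.
move=> w1; have w0 : w != 0 by rewrite -normr_gt0 (lt_trans _ w1).
move/(rescaleV _ w0); elim: k => [|k IH]; first by rewrite expr0.
move=> /pow_descent_lt1 Jk; apply/IH/Jk => //.
by rewrite normrZ norm_mpolyX mulr1 normfV invf_lt1 // (lt_trans _ w1).
Qed.

(** The descent stops at exponent 1, since the Cesaro estimate itself consumes one factor
    [Y - 1]. *)
Lemma closed_ideal_radical_circle (k : nat) :
  `|w| = 1 -> J (('X_j - w%:MP) ^+ k.+1) -> J ('X_j - w%:MP).
Proof.
move=> w1; have w0 : w != 0 by rewrite -normr_gt0 w1.
move/(rescaleV _ w0); rewrite rescale //; elim: k => [|k IH].
  by rewrite expr1; exact: idealM.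
move=> /pow_descent_le1 Jk; apply/IH/Jk => //.
by rewrite normrZ norm_mpolyX mulr1 normfV w1 invr1.
Qed.

End Point.

Lemma closed_ideal_unit_polydisc (I : set {mpoly R[i][n]}) (z : 'I_n -> R[i])
    (N : nat) :
  is_ideal I -> (forall j, `|z j| <= 1) ->
  (forall j, I (('X_j - (z j)%:MP) ^+ N.+1)) ->
  (forall j, `|z j| = 1 -> I ('X_j - (z j)%:MP)) ->
  closure I `<=` I.
Proof.
move=> idI z1 Ipow Icirc.
pose e j (i : 'I_N.+1) := ('X_j - (z j)%:MP) ^+ i : {mpoly R[i][n]}.
(* On the circle the Taylor coefficients with [i > 0] are unbounded in [m]; there ['X_j] is
   congruent to [z j], so the constant term suffices. *)
pose c j m (i : 'I_N.+1) := if `|z j| == 1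
  then if i == ord0 then z j ^+ m else 0 else taylor_coef (z j) m i.
apply: (@closed_of_power_expansion _ _ _ _ e c) => // j => [i|m]; rewrite /c.
  have [zj|zj] := eqVneq `|z j| 1.
    exists 1 => m; case: ifP => _; last by rewrite normr0.
    by rewrite normrX zj expr1n.
  exists ((1 - `|z j|)^-1 ^+ i) => m; apply: taylor_coef_bound.
  by rewrite lt_neqAle zj z1.
have [zj|zj] := eqVneq `|z j| 1; last exact: taylor_congr.
rewrite big_ord_recl eqxx big1 => [|i _]; last by rewrite scale0r.
rewrite /e expr0 addr0 alg_mpolyC rmorphXn subrXX mulrC.
by apply: (idealM idI); exact: Icirc.
Qed.

End ComplexCoefficients.

(** * Assembling the two cases of the closure formula *)

Theorem theorem1p8 (R : realType) (n : nat) (z : 'I_n -> R[i])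
    (I : set {mpoly R[i][n]}) (hI : primary_to I (max_ideal z)) :
  ((forall j, `|z j| <= 1) -> closure I = ideal_add I (circle_ideal z)) /\
  (~ (forall j, `|z j| <= 1) -> closure I = ideal_gen [set 1]).
Proof.
have [[idI _ _] radI] := hI.
have : forall j, exists k : nat, I (('X_j - (z j)%:MP) ^+ k.+1).
  move=> j; suff : radical I ('X_j - (z j)%:MP) by [].
  by rewrite radI => J [_]; apply; exists j.
move=> /choice[k Ik].
have idcI := closure_ideal _ idI.
have clcI : closure (closure I) `<=` closure I.
  by rewrite -(closure_id _).1 //; exact: closed_closure.
have cIk j : closure I (('X_j - (z j)%:MP) ^+ (k j).+1) by exact: subset_closure.
split=> [z1|/existsNP[j zj]]; rewrite eqEsubset; split.
- have idK : is_ideal (ideal_add I (circle_ideal z)).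
    by apply: ideal_add_ideal => //; exact: ideal_gen_ideal.
  have IK : I `<=` ideal_add I (circle_ideal z).
    move=> x Ix; exists x => //; exists 0; last exact: addr0.
    exact: (ideal_gen_ideal _).1.
  apply: subset_trans (closureS IK) _.
  (* It remains to see that the sum is closed; the maximum of the [k j] gives one exponent for all
     variables. *)
  apply: (@closed_ideal_unit_polydisc _ _ _ z (\max_j k j)) => // j.
    by apply/IK/(ideal_pow_le idI _ _ _ _ (Ik j)); rewrite ltnS leq_bigmax.
  move=> zj; exists 0; first exact: idI.1.
  exists ('X_j - (z j)%:MP); last exact: add0r.
  by move=> J [_]; apply; exists j.
- move=> _ [x Ix [y Cy <-]]; apply: (idealD idcI); first exact: subset_closure.
  (* By minimality of [circle_ideal z], only its generators need to lie in [closure I]. *)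
  apply: Cy; split=> // _ [j zj <-].
  exact: (closed_ideal_radical_circle idcI clcI _ zj (cIk j)).
- move=> x _ J [idJ J1]; rewrite -[x]mulr1; apply: (idealM idJ); exact: J1.
- move=> x G1; apply: G1; split=> // _ ->.
  apply: (closed_ideal_trivial idcI clcI _ _ (cIk j)).
  (* The order on [R[i]] is partial; the negation reverses the inequality because both sides are
     real. *)
  by rewrite real_ltNge ?normr_real ?real1 //; exact/negP.
Qed.
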